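(* Let $G$ be the group of automorphisms of the binary rooted tree $\{x,y\}^*$ generated by $a=\langle\langle b,1\rangle\rangle(x,y)$ and $b=\langle\langle a,1\rangle\rangle$. Then the subsemigroup $\{a,b\}^*$ of $G$ (the submonoid generated by $a$ and $b$) is free, on $a$ and $b$; therefore $G$ has exponential growth.
   Context: The vertices of the binary rooted tree are the words in $\{x,y\}^*$. Automorphisms act on the right; $\langle\langle g_x,g_y\rangle\rangle\pi$, with $\pi$ a permutation of $\{x,y\}$, is the automorphism sending $iw$ to $i^{\pi}\,w^{g_i}$ for $i\in\{x,y\}$ and any word $w$ ($\pi$ is omitted if trivial). Thus $a,b$ are defined recursively by $(xw)^a=y\,w^b$, $(yw)^a=x\,w$, $(xw)^b=x\,w^a$, $(yw)^b=y\,w$. This $G$ is the iterated monodromy group of $z^2-1$. *)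

(* Defs.v *)
From HB Require Import structures.
From mathcomp Require Import all_boot all_order all_algebra all_fingroup.
From mathcomp Require Import finmap all_classical all_reals.

Set Implicit Arguments.
Unset Strict Implicit.
Unset Printing Implicit Defensive.

Import Order.TTheory GRing.Theory Num.Theory.
Local Open Scope classical_set_scope.
Local Open Scope group_scope.

Section GroupNotions.
Variable gT : groupType.
Implicit Types (S A M H : set gT) (g : gT) (n : nat).

Definition submonoid_generated S : set gT :=
  smallest (fun A => monoid_closed [in A]) S.

Definition subgroup_generated S : set gT :=
  smallest (fun A => group_closed [in A]) S.

(* [seq I] is the free monoid on [I]: [M] is free on the family [s] when the
   monoid morphism extending [s] is a bijection from [seq I] onto [M]. *)
Definition free_monoid_on M (I : Type) (s : I -> gT) : Prop :=
  set_bij [set: seq I] M (fun w => \prod_(i <- w) s i).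

Definition word_ball S n : set gT :=
  [set g | exists w : seq gT,
    [/\ (size w <= n)%N,
        forall s, s \in w -> S s \/ S s^-1
      & g = \prod_(s <- w) s]].

(* For finite [S] the balls are finite; [fset_set] would return the empty set
   on an infinite one. *)
Definition growth S n : nat := #|` fset_set (word_ball S n)|.

Definition finite_generating_set H S : Prop :=
  finite_set S /\ subgroup_generated S = H.

(* The property does not depend on the finite generating set, so it is required
   of all of them, together with the existence of one. *)
Definition exponential_growth (R : realType) H : Prop :=
  (exists S, finite_generating_set H S) /\
  (forall S, finite_generating_set H S ->
    exists c : R, (1 < c)%R /\ forall n, (c ^+ n <= (growth S n)%:R)%R).

End GroupNotions.

Variant letter := lx | ly.

Definition bool_of_letter l := if l is lx then true else false.
Definition letter_of_bool b := if b then lx else ly.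
Lemma bool_of_letterK : cancel bool_of_letter letter_of_bool.
Proof. by case. Qed.
HB.instance Definition _ := Finite.copy letter (can_type bool_of_letterK).

(* Vertices of the binary rooted tree: the root is [[::]], and the children of
   [u] are [rcons u lx] and [rcons u ly]. *)
Definition vertex := seq letter.

Definition child (u v : vertex) : Prop := exists i, v = rcons u i.

Definition tree_automorphism (f : vertex -> vertex) : Prop :=
  [/\ bijective f, f [::] = [::] & forall u v, child (f u) (f v) <-> child u v].

Record tree_aut := TreeAut {
  aut_act :> vertex -> vertex;
  aut_actP : `[< tree_automorphism aut_act >] }.
HB.instance Definition _ := [isSub for aut_act].
HB.instance Definition _ := [Choice of tree_aut by <:].

Lemma tree_autP (g : tree_aut) : tree_automorphism g.
Proof. exact/asboolP/aut_actP. Qed.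

Lemma tree_aut_ext (g h : tree_aut) : g =1 h -> g = h.
Proof. by move=> gh; apply/val_inj/funext. Qed.

Definition mk_aut f (fP : tree_automorphism f) : tree_aut :=
  TreeAut (introT (asboolP _) fP).

Lemma id_aut_subproof : tree_automorphism id.
Proof. by split=> //; exists id. Qed.

Lemma comp_aut_subproof (g h : tree_aut) : tree_automorphism (h \o g).
Proof.
have [gB g0 gC] := tree_autP g; have [hB h0 hC] := tree_autP h.
split; first exact: bij_comp.
- by rewrite /= g0.
- by move=> u v /=; apply: iff_trans (hC _ _) (gC _ _).
Qed.

Lemma aut_surj (g : tree_aut) v : exists u, g u == v.
Proof. by have [[g' _ g'K] _ _] := tree_autP g; exists (g' v); rewrite g'K. Qed.

Definition aut_inv_fun (g : tree_aut) v := xchoose (aut_surj g v).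

Lemma aut_inv_funK (g : tree_aut) : cancel (aut_inv_fun g) g.
Proof. by move=> v; apply/eqP/(xchooseP (aut_surj g v)). Qed.

Lemma aut_funK (g : tree_aut) : cancel g (aut_inv_fun g).
Proof.
move=> u; have [/bij_inj gI _ _] := tree_autP g.
by apply: gI; rewrite aut_inv_funK.
Qed.

Lemma inv_aut_subproof g : tree_automorphism (aut_inv_fun g).
Proof.
have [gB g0 gC] := tree_autP g; split.
- by exists g; [exact: aut_inv_funK | exact: aut_funK].
- by rewrite -{1}g0 aut_funK.
- by move=> u v; apply: iff_trans (iff_sym (gC _ _)) _; rewrite !aut_inv_funK.
Qed.

(* Automorphisms act on the right: [g * h] applies [g] first. *)
Definition aut_one := mk_aut id_aut_subproof.
Definition aut_mul g h := mk_aut (comp_aut_subproof g h).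
Definition aut_inv g := mk_aut (inv_aut_subproof g).

Lemma aut_mulA : associative aut_mul.
Proof. by move=> g h k; apply: tree_aut_ext. Qed.
Lemma aut_mul1g : left_id aut_one aut_mul.
Proof. by move=> g; apply: tree_aut_ext. Qed.
Lemma aut_mulg1 : right_id aut_one aut_mul.
Proof. by move=> g; apply: tree_aut_ext. Qed.
Lemma aut_mulVg : left_inverse aut_one aut_inv aut_mul.
Proof. by move=> g; apply: tree_aut_ext => u; exact: aut_inv_funK. Qed.
Lemma aut_mulgV : right_inverse aut_one aut_inv aut_mul.
Proof. by move=> g; apply: tree_aut_ext => u; exact: aut_funK. Qed.

HB.instance Definition _ := isGroup.Build tree_aut
  aut_mulA aut_mul1g aut_mulg1 aut_mulVg aut_mulgV.

Lemma aut_mulE (g h : tree_aut) u : (g * h) u = h (g u).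
Proof. by []. Qed.

(* [wreath gx gy pi] is <<gx, gy>>pi, sending [i :: w] to [pi i :: g_i w]. *)
Definition wreath_fun (gx gy : tree_aut) (pi : {perm letter}) (u : vertex) :=
  if u is i :: w then pi i :: (if i is lx then gx else gy) w else [::].

Lemma child_nil v : child [::] v <-> size v = 1%N.
Proof.
split=> [[i ->]//|]; case: v => [|i [|j v]] // _; first by exists i.
Qed.

Lemma child_cons i j u v : child (i :: u) (j :: v) <-> i = j /\ child u v.
Proof.
split=> [[k]|[-> [k ->]]]; last by exists k.
by rewrite rcons_cons => -[-> ->]; split=> //; exists k.
Qed.

Lemma child_to_nil u : ~ child u [::].
Proof. by case=> i; case: u. Qed.

Lemma aut_size (g : tree_aut) u : size (g u) = size u.
Proof.
have [_ g0 gC] := tree_autP g.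
elim/last_ind: u => [|u i IH]; first by rewrite g0.
have /gC [j ->] : child u (rcons u i) by exists i.
by rewrite !size_rcons IH.
Qed.

Lemma wreath_subproof gx gy pi : tree_automorphism (wreath_fun gx gy pi).
Proof.
split=> //.
- exists (fun u => if u is i :: w then
      (pi^-1)%g i :: aut_inv_fun (if (pi^-1)%g i is lx then gx else gy) w
    else [::]) => [] [|i w] //=.
  + by rewrite permK; case: i; rewrite aut_funK.
  + by rewrite permKV; case: ((pi^-1)%g i); rewrite aut_inv_funK.
- move=> [|i u] [|j v] /=.
  + by split=> /child_to_nil.
  + by rewrite !child_nil /=; case: j; rewrite !aut_size.
  + by split=> /child_to_nil.
  + rewrite !child_cons; split=> [[/perm_inj <-]|[<-]] H; split=> //; move: H;
    by case: i; [have [_ _ ->] := tree_autP gx | have [_ _ ->] := tree_autP gy].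
Qed.

Definition wreath gx gy pi : tree_aut := mk_aut (wreath_subproof gx gy pi).

Variant generator := gen_a | gen_b.

Fixpoint gen_fun (s : generator) (u : vertex) : vertex :=
  match s, u with
  | _, [::] => [::]
  | gen_a, lx :: w => ly :: gen_fun gen_b w
  | gen_a, ly :: w => lx :: w
  | gen_b, lx :: w => lx :: gen_fun gen_a w
  | gen_b, ly :: w => ly :: w
  end.

Fixpoint gen_inv (s : generator) (u : vertex) : vertex :=
  match s, u with
  | _, [::] => [::]
  | gen_a, ly :: w => lx :: gen_inv gen_b w
  | gen_a, lx :: w => ly :: w
  | gen_b, lx :: w => lx :: gen_inv gen_a w
  | gen_b, ly :: w => ly :: w
  end.

Lemma gen_funK s : cancel (gen_fun s) (gen_inv s).
Proof. by move=> u; elim: u s => [|[] w IH] [] //=; rewrite IH. Qed.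

Lemma gen_invK s : cancel (gen_inv s) (gen_fun s).
Proof. by move=> u; elim: u s => [|[] w IH] [] //=; rewrite IH. Qed.

Lemma gen_size s u : size (gen_fun s u) = size u.
Proof. by elim: u s => [|[] w IH] [] //=; rewrite IH. Qed.

Lemma gen_subproof s : tree_automorphism (gen_fun s).
Proof.
split; [by exists (gen_inv s); [exact: gen_funK | exact: gen_invK]
       | by case: s |].
move=> u; elim: u s => [|i u IH] s [|j v].
- by case: s; split=> /child_to_nil.
- have -> : gen_fun s [::] = [::] by case: s.
  by rewrite !child_nil gen_size.
- have -> : gen_fun s [::] = [::] by case: s.
  by split=> /child_to_nil.
- by case: s i j => [] [] []; rewrite /= !child_cons ?IH; split=> -[].
Qed.

Definition a : tree_aut := mk_aut (gen_subproof gen_a).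
Definition b : tree_aut := mk_aut (gen_subproof gen_b).

Lemma aE : a = wreath b 1 (tperm lx ly).
Proof. by apply: tree_aut_ext => -[|[] w] //=; rewrite ?tpermL ?tpermR. Qed.

Lemma bE : b = wreath a 1 1.
Proof. by apply: tree_aut_ext => -[|[] w] //=; rewrite perm1. Qed.

Definition G : set tree_aut := subgroup_generated [set a; b].

Definition ab (s : generator) : tree_aut := if s is gen_a then a else b.

(* Main.v *)
Require Import Defs.
From HB Require Import structures.
From mathcomp Require Import all_boot all_order all_algebra all_fingroup.
From mathcomp Require Import finmap all_classical all_reals.
From mathcomp Require Import lra.

Set Implicit Arguments.
Unset Strict Implicit.
Unset Printing Implicit Defensive.

Import Order.TTheory GRing.Theory Num.Theory.
Local Open Scope classical_set_scope.
Local Open Scope group_scope.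

(** Freeness rests on reading the recursion [a = <<b, 1>>(x, y)],
[b = <<a, 1>>] on positive words. The section at a vertex of the automorphism
spelled by a word in [a, b] is again spelled by an explicit positive word,
[word_section], and each letter of a word contributes one letter to exactly
one of its two sections at level one ([size_word_section]). The section at [x]
is therefore never longer than the word, and it turns the first letter [a] into
[b] and [b] into [a]; taking it twice preserves the first letter and strictly
shortens every word with at least two letters ([size_word_section2]). If two
words spell the same automorphism, so do their double sections at [x]. Descent
thus reduces a coincidence between words with different first letters (or
between an empty and a nonempty word) to one between words of length at most
one, where it is refuted by looking at the vertex [xx] ([word_aut_ohead]).
Since a group is cancellative, equal first letters can be removed, and equality
of automorphisms forces equality of words ([word_aut_inj]).

Exponential growth follows for any finitely generated group containing a free
monoid of rank at least two ([exponential_growth_free_monoid]). Given a finite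
generating set [S], choose [K] such that the ball of radius [K] contains the
free generators. The words of length [n] in them give at least [2 ^ n] elements
of the ball of radius [n * K], and by submultiplicativity of growth this ball
has at most [growth S n ^ K] elements. Hence [growth S n] is at least [c ^ n]
for every [n] as soon as [c ^ K <= 2], and such a [c > 1] exists. *)

(** * A number above 1 with a prescribed power at most 2 *)

Lemma bernoulli (R : realFieldType) (x : R) n :
  (0 <= x <= 1 -> 1 - x *+ n <= (1 - x) ^+ n)%R.
Proof.
move=> /andP[x0 x1]; elim: n => [|n IH]; first by rewrite expr0 mulr0n subr0.
rewrite exprS; apply: (@le_trans _ _ ((1 - x) * (1 - x *+ n))%R).
  have : (0 <= x * (x *+ n))%R by rewrite mulr_ge0 // mulrn_wge0.
  rewrite mulrSr; nra.
by rewrite ler_wpM2l // subr_ge0.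
Qed.

(** Such a [c] replaces the [k]-th root of 2, whose existence would need
completeness: Bernoulli's inequality for [c^-1 = 1 - 1 / (2 (k + 1))] gives
[c ^- k >= 1 / 2]. *)
Lemma exists_gt1_expr_le2 (R : realFieldType) k :
  exists c : R, (1 < c)%R /\ (c ^+ k <= 2)%R.
Proof.
pose x : R := ((2 * k.+1)%:R^-1)%R.
have k0 : (0 < (2 * k.+1)%:R :> R)%R by rewrite ltr0n.
have x0 : (0 < x)%R by rewrite invr_gt0.
have xk : (x *+ k <= 2^-1)%R.
  rewrite -[leLHS]mulr_natl ler_pdivrMr // natrM mulKf ?pnatr_eq0 //.
  by rewrite ler_nat.
have x1 : (x < 1)%R.
  by rewrite invf_lt1 // ltr1n mul2n -addnn addSn ltnS addnS ltnS leq0n.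
have x1' : (0 < 1 - x)%R by rewrite subr_gt0.
exists (1 - x)^-1%R; split; first by rewrite invf_gt1 //; lra.
have : (1 - x *+ k <= (1 - x) ^+ k)%R by apply: bernoulli; rewrite !ltW.
have := exprn_gt0 k x1'; set y := (_ ^+ k)%R => y0 hy.
rewrite exprVn -/y -[leLHS]mul1r ler_pdivrMr //; lra.
Qed.

(** * Growth of finitely generated groups *)

Section WordBalls.
Variable gT : groupType.
Implicit Types (S H : set gT) (g : gT) (m n k : nat).

Lemma word_ball_sub S m n : (m <= n)%N -> word_ball S m `<=` word_ball S n.
Proof.
by move=> mn _ [w [wm wS ->]]; exists w; split=> //; exact: leq_trans mn.
Qed.

Lemma word_ball0 S : word_ball S 0 = [set 1].
Proof.
apply/seteqP; split=> [_ [w [+ _ ->]]|_ ->].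
  by rewrite leqn0 => /nilP ->; rewrite big_nil.
by exists [::]; rewrite big_nil.
Qed.

Lemma word_ball1_sub S :
  word_ball S 1 `<=` [set 1] `|` (S `|` [set s^-1 | s in S]).
Proof.
move=> _ [[|s [|t w]] [//= _ wS ->]]; first by left; rewrite /= big_nil.
right; rewrite big_seq1; have [|sS|sS] := wS s; rewrite ?mem_head //; first by left.
by right; exists s^-1 => //; rewrite invgK.
Qed.

Lemma mem_word_ballM S m n g h :
  word_ball S m g -> word_ball S n h -> word_ball S (m + n) (g * h).
Proof.
move=> [u [um uS ->]] [v [vn vS ->]]; exists (u ++ v); split.
- by rewrite size_cat leq_add.
- by move=> s; rewrite mem_cat => /orP[/uS|/vS].
- by rewrite big_cat.
Qed.

Lemma mem_word_ballV S n g : word_ball S n g -> word_ball S n g^-1.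
Proof.
move=> [w [wn wS ->]]; exists (rev [seq s^-1 | s <- w]); split.
- by rewrite size_rev size_map.
- move=> s; rewrite mem_rev => /mapP[t /wS tS ->].
  by rewrite invgK; case: tS => tS; [right | left].
- by rewrite -map_rev big_map prodgV revK.
Qed.

Lemma mem_word_ball_gen S s : S s -> word_ball S 1 s.
Proof.
move=> sS; exists [:: s]; split=> //; last by rewrite big_seq1.
by move=> t /[!inE] /eqP ->; left.
Qed.

Lemma word_ballD S m n :
  word_ball S (m + n) = [set p.1 * p.2 | p in word_ball S m `*` word_ball S n].
Proof.
apply/seteqP; split=> [_ [w [wmn wS ->]]|_ [[g h] [/= gm hn] <-]]; last first.
  exact: mem_word_ballM.
exists (\prod_(s <- take m w) s, \prod_(s <- drop m w) s) => /=; last first.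
  by rewrite -big_cat cat_take_drop.
split=> /=.
- exists (take m w); split=> // [|s /mem_take /wS //].
  by rewrite size_take_min geq_minl.
- exists (drop m w); split=> // [|s /mem_drop /wS //].
  by rewrite size_drop leq_subLR.
Qed.

Lemma finite_word_ball S n : finite_set S -> finite_set (word_ball S n).
Proof.
move=> finS; elim: n => [|n IH]; first by rewrite word_ball0.
rewrite -add1n word_ballD; apply/finite_image/finite_setX => //.
apply: sub_finite_set (@word_ball1_sub S) _.
by rewrite !finite_setU; split=> //; split=> //; exact: finite_image.
Qed.

Lemma growthD S m n :
  finite_set S -> (growth S (m + n) <= growth S m * growth S n)%N.
Proof.
move=> finS; have fin k := finite_word_ball k finS.
have mem k g : (g \in fset_set (word_ball S k)) = (g \in word_ball S k).
  by rewrite in_fset_set.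
rewrite -(size_allpairs *%g); apply: uniq_leq_size => [|g]; first exact: fset_uniq.
rewrite /= mem inE word_ballD => -[[g1 g2] [/= g1m g2n] <-].
by apply: allpairs_f; rewrite /= mem inE.
Qed.

(** Iterated submultiplicativity, the form in which a lower bound on balls of
radius a multiple of [k] is brought back to all radii, small ones included. *)
Lemma growthM S n k : finite_set S -> (growth S (n * k) <= growth S n ^ k)%N.
Proof.
move=> finS; elim: k => [|k IH].
  by rewrite muln0 expn0 /growth word_ball0 fset_set1 cardfs1.
rewrite mulnS expnS (leq_trans (growthD _ _ finS)) //.
by rewrite leq_mul2l IH orbT.
Qed.

Lemma subgroup_generated_word_ball S :
  subgroup_generated S `<=` \bigcup_n word_ball S n.
Proof.
apply: smallest_sub; last by move=> s sS; exists 1%N => //; exact: mem_word_ball_gen.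
split=> [|g h]; rewrite !inE; first by exists 0%N => //; rewrite word_ball0.
move=> [m _ gm] [n _ hn]; exists (m + n)%N => //.
exact/mem_word_ballM/mem_word_ballV.
Qed.

Lemma mem_word_ball_prod S k (I : Type) (s : I -> gT) (w : seq I) :
  (forall i, word_ball S k (s i)) ->
  word_ball S (size w * k) (\prod_(i <- w) s i).
Proof.
move=> sS; elim: w => [|i w IH]; first by rewrite big_nil word_ball0.
by rewrite big_cons mulSn; exact: mem_word_ballM.
Qed.

(** Freeness makes the words of a given length in the free generators spell
pairwise distinct elements, all of them in one ball. *)
Lemma leq_growth_free S k (I : finType) (s : I -> gT) n :
    finite_set S -> (forall i, word_ball S k (s i)) ->
    injective (fun w : seq I => \prod_(i <- w) s i) ->
  (#|I| ^ n <= growth S (n * k))%N.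
Proof.
move=> finS sS s_inj; rewrite -card_tuple.
pose f (t : n.-tuple I) := \prod_(i <- t) s i.
have f_inj : injective f by move=> t u /s_inj /val_inj.
have -> : #|{: n.-tuple I}| = #|` [fset f t | t in {: n.-tuple I}]%fset|.
  by rewrite card_imfset //= -cardE.
apply/fsubset_leq_card/fsubsetP => _ /imfsetP[t _ ->].
rewrite in_fset_set; last exact: finite_word_ball.
by rewrite inE -[n in (n * k)%N](size_tuple t); exact: mem_word_ball_prod.
Qed.

(** For each finite generating set [S], the constant is any [c > 1] whose
[K]-th power is at most 2, where the ball of radius [K] contains the free
generators: then [(c ^ n) ^ K <= 2 ^ n <= growth S (n * K) <= growth S n ^ K]. *)
Lemma exponential_growth_free_monoid (R : realType) H (I : finType)
    (s : I -> gT) :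
    (exists S, finite_generating_set H S) -> (1 < #|I|)%N ->
    (forall i, H (s i)) ->
    injective (fun w : seq I => \prod_(i <- w) s i) ->
  exponential_growth R H.
Proof.
move=> fgH I2 sH s_inj; split=> // S [finS genS].
have /choice[k sk] i : exists k, word_ball S k (s i).
  by have := sH i; rewrite -genS => /subgroup_generated_word_ball[k _]; exists k.
(* The successor makes K positive, so that K-th powers can be compared. *)
pose K := (\max_i k i).+1.
have sK i : word_ball S K (s i).
  by apply: word_ball_sub (sk i); rewrite ltnW // ltnS leq_bigmax.
have [c [c1 cK]] := exists_gt1_expr_le2 R K; exists c; split=> // n.
have c0 : (0 <= c)%R by rewrite ltW // (lt_trans ltr01).
rewrite -(@ler_pXn2r _ K) ?nnegrE ?exprn_ge0 ?ler0n //.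
rewrite exprAC; apply: (@le_trans _ _ (2 ^+ n)%R).
  by rewrite lerXn2r ?nnegrE ?exprn_ge0 ?ler0n.
rewrite -!natrX ler_nat; apply: leq_trans (growthM n K finS).
apply: leq_trans (leq_growth_free n finS sK s_inj).
by case: (posnP n) => [-> //|n0]; rewrite leq_exp2r.
Qed.

End WordBalls.

(** * Sections of positive words *)

Definition bool_of_generator s := if s is gen_a then true else false.
Definition generator_of_bool c := if c then gen_a else gen_b.
Lemma bool_of_generatorK : cancel bool_of_generator generator_of_bool.
Proof. by case. Qed.
HB.instance Definition _ := Finite.copy generator (can_type bool_of_generatorK).

Lemma card_generator : #|{: generator}| = 2%N.
Proof.
rewrite -card_bool; apply/eqP; rewrite eqn_leq.
rewrite (leq_card _ (can_inj bool_of_generatorK)).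
by rewrite (@leq_card _ _ generator_of_bool) // => -[] [].
Qed.

Definition word_aut (w : seq generator) : tree_aut := \prod_(s <- w) ab s.

(** The section of [word_aut w] at the vertex [l] of level one, as a positive
word. The argument [l] is the image of the starting vertex under the letters
read so far: at [x], [a] has section [b] and moves to [y] while [b] has section
[a] and stays; at [y], both have trivial section and [a] moves to [x]. *)
Fixpoint word_section (l : letter) (w : seq generator) : seq generator :=
  match w, l with
  | [::], _ => [::]
  | gen_a :: w', lx => gen_b :: word_section ly w'
  | gen_a :: w', ly => word_section lx w'
  | gen_b :: w', lx => gen_a :: word_section lx w'
  | gen_b :: w', ly => word_section ly w'
  end.

Lemma word_aut_cons s w t : word_aut (s :: w) t = word_aut w (ab s t).
Proof. by rewrite /word_aut big_cons. Qed.

Lemma word_aut_section l w :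
  exists m, forall t, word_aut w (l :: t) = m :: word_aut (word_section l w) t.
Proof.
elim: w l => [|s w IH] l; first by exists l => t; rewrite /word_aut big_nil.
have [mx Hx] := IH lx; have [my Hy] := IH ly.
case: s l => [] [] /=; [exists my|exists mx|exists mx|exists my] => t;
  by rewrite word_aut_cons /= ?word_aut_cons (Hx, Hy).
Qed.

Lemma word_section_eq l u v :
  word_aut u = word_aut v ->
  word_aut (word_section l u) = word_aut (word_section l v).
Proof.
have [m Hu] := word_aut_section l u; have [p Hv] := word_aut_section l v.
by move=> uv; apply: tree_aut_ext => t; have := Hu t; rewrite uv Hv => -[].
Qed.

(** Reading [w] from [x] and from [y] visits opposite vertices at every step,
and a letter has a nontrivial section at [x] only. *)
Lemma size_word_section w :
  (size (word_section lx w) + size (word_section ly w))%N = size w.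
Proof.
by elim: w => [|[] w IH] //=; rewrite -IH addSn // addnC.
Qed.

Lemma size_word_section_le l w : (size (word_section l w) <= size w)%N.
Proof.
by rewrite -(size_word_section w); case: l; rewrite ?leq_addl ?leq_addr.
Qed.

(** The section at [x] of a nonempty word is nonempty, so the section at [y]
misses at least one letter. *)
Lemma size_word_section_y w :
  (0 < size w)%N -> (size (word_section ly w) < size w)%N.
Proof. by case: w => [|[] w] //= _; rewrite ltnS size_word_section_le. Qed.

Lemma ohead_word_section2 w :
  ohead (word_section lx (word_section lx w)) = ohead w.
Proof. by case: w => [|[] w]. Qed.

(** One section at [x] is not enough: it has full length for the words
[b ^ k] and [b ^ k * a]. Its value on those, [a ^ k] or [a ^ k * b], does lose
a letter at the next step. *)
Lemma size_word_section2 w :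
  (1 < size w)%N -> (size (word_section lx (word_section lx w)) < size w)%N.
Proof.
case: w => [|[] w] //=; rewrite !ltnS => w0.
  exact: leq_ltn_trans (size_word_section_le _ _) (size_word_section_y w0).
apply: leq_trans (size_word_section_y _) (size_word_section_le lx _).
by case: w w0 => [|[] w].
Qed.

(** The descent: double sections at [x] keep the first letters and the
equality of the automorphisms, until both words have at most one letter. The
option-valued head also covers the case where one word is empty. *)
Lemma word_aut_ohead u v : word_aut u = word_aut v -> ohead u = ohead v.
Proof.
have [n] := ubnP (size u + size v)%N.
elim: n => // n IH in u v *; rewrite ltnS => uvn uv.
pose f w := word_section lx (word_section lx w).
have fle w : (size (f w) <= size w)%N.
  exact: leq_trans (size_word_section_le _ _) (size_word_section_le _ _).
have IHf : (size (f u) + size (f v) < size u + size v)%N -> ohead u = ohead v.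
  move=> lt_f; rewrite -ohead_word_section2 -[RHS]ohead_word_section2.
  by apply: IH (leq_trans lt_f uvn) _; do 2!apply: word_section_eq.
have [u1|u2] := leqP (size u) 1; last first.
  by apply: IHf; rewrite -addSn leq_add // size_word_section2.
have [v1|v2] := leqP (size v) 1; last first.
  by apply: IHf; rewrite -addnS leq_add // size_word_section2.
(* The vertex xx separates the three words left: the empty word fixes it, [a]
   sends it to yx and [b] sends it to xy. *)
have /(congr1 (fun g : tree_aut => g [:: lx; lx])) := uv.
by move: u v u1 v1 {uv uvn IHf} => [|[] []] [|[] []] //= _ _;
   rewrite /word_aut !(big_nil, big_seq1).
Qed.

Lemma word_aut_inj : injective word_aut.
Proof.
elim=> [|s u IH] [|t v] uv; have // [st] := word_aut_ohead uv.
rewrite -st; congr (_ :: _); apply: IH.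
by move: uv; rewrite /word_aut !big_cons st => /mulgI.
Qed.

(** * The submonoid and the group generated by a and b *)

Lemma submonoid_generated_prod (gT : groupType) (I : Type) (s : I -> gT) :
  submonoid_generated (range s) = range (fun w : seq I => \prod_(i <- w) s i).
Proof.
apply/seteqP; split.
  apply: smallest_sub => [|_ [i _ <-]]; last by exists [:: i]; rewrite ?big_seq1.
  split=> [|u v]; rewrite !inE; last move=> [{}u _ <-] [{}v _ <-].
    by exists [::]; rewrite ?big_nil.
  by exists (u ++ v); rewrite ?big_cat.
move=> _ [w _ <-] A [[A1 AM] sA].
elim: w => [|i w IH]; first by rewrite big_nil; move: A1; rewrite !inE.
rewrite big_cons; have := AM (s i) (\prod_(j <- w) s j).
by rewrite !inE; apply=> //; apply: sA; exists i.
Qed.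

Lemma range_ab : range ab = [set a; b].
Proof.
apply/seteqP; split=> [_ [[] _ <-]|_ [->|->]]; [by left|by right| |].
  by exists gen_a.
by exists gen_b.
Qed.

Theorem proposition3p5 (R : realType) :
  free_monoid_on (submonoid_generated [set a; b]) ab /\
  exponential_growth R G.
Proof.
split.
  rewrite -range_ab submonoid_generated_prod; split=> // u v _ _.
  exact: word_aut_inj.
apply: (@exponential_growth_free_monoid _ _ _ generator ab _ _ _ word_aut_inj).
- exists [set a; b]; split=> //; exact: finite_set2.
- by rewrite card_generator.
- by move=> s; apply: sub_gen_smallest; rewrite -range_ab; exists s.
Qed.
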